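(* Let $\lambda>\aleph_0$ be a regular cardinal and let $D$ be a doubly$^+$ regular filter on $\lambda$. Then the principle $\square^{\mathrm{fin}}_{\lambda,D}$ holds.
   Context: A family of sets is a regular family if finite intersections of members of the family are non-empty but all infinite intersections (i.e. intersections of infinitely many members) are empty. A filter is $\mu$-regular if it contains a regular family of size $\mu$. A filter on $\lambda$, or on a set of cardinality $\lambda$, is called regular if it is $\lambda$-regular. A filter $D$ on a regular cardinal $\lambda$ is called doubly$^+$ regular if there are pairwise disjoint sets $u_i\subseteq\lambda$, $i<\lambda$, each of cardinality $\lambda$, and regular filters $D_i$ on $u_i$, such that for all $A\subseteq\lambda$: if there is a club $C\subseteq\lambda$ with $A\cap u_i\in D_i$ for all $i\in C$, then $A\in D$. The principle $\square^{\mathrm{fin}}_{\lambda,D}$ states: $D$ is a filter on the cardinal $\lambda$ and there exist finite sets $C_\alpha^\xi$ and integers $n_\xi$, for each $\alpha<\lambda^+$ and $\xi<\lambda$, such that for all $\xi<\lambda$ and $\alpha<\lambda^+$: (i) $C_\alpha^\xi\subseteq\alpha+1$; (ii) if $B\subset\lambda^+$ is a finite set of ordinals and $\alpha<\lambda^+$ is such that $B\subseteq\alpha+1$, then $\{\xi<\lambda: B\subseteq C_\alpha^\xi\}\in D$; (iii) $\beta\in C_\alpha^\xi$ implies $C_\beta^\xi=C_\alpha^\xi\cap(\beta+1)$; (iv) $|C_\alpha^\xi|<n_\xi$. *)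

(* Defs.v *)
From HB Require Import structures.
From mathcomp Require Import all_boot all_order finmap.
From mathcomp Require Import boolp classical_sets functions cardinality filter.
From mathcomp Require wochoice.
Set Implicit Arguments.
Unset Strict Implicit.
Unset Printing Implicit Defensive.
Import Order.TTheory.
Local Open Scope classical_set_scope.
Local Open Scope card_scope.
Local Open Scope order_scope.

(* MathComp has no ordinals.  A cardinal is represented by a well-ordered type
   whose order type is that cardinal, regarded as an initial ordinal: the
   ordinals below it are the points of the type, and the ordinal x itself is
   identified with the set [set y | y < x] of its predecessors. *)

Definition well_ordered d (T : orderType d) : Prop :=
  wochoice.well_order (<=%O : rel T).

Definition is_cardinal d (L : orderType d) : Prop :=
  well_ordered L /\ forall x : L, ~~ ([set: L] #<= [set y : L | y < x]).

(* The order type of M is the least ordinal of cardinality greater than that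
   of L. *)
Definition is_successor_cardinal d (L : orderType d) d' (M : orderType d') :
    Prop :=
  [/\ well_ordered M,
      ~~ ([set: M] #<= [set: L]) &
      forall a : M, [set b : M | b < a] #<= [set: L]].

Definition unbounded d (L : orderType d) (A : set L) : Prop :=
  forall x : L, exists2 y, A y & x <= y.

Definition is_regular_cardinal d (L : orderType d) : Prop :=
  [/\ is_cardinal L, infinite_set [set: L] &
      forall A : set L, unbounded A -> A #= [set: L]].

(* The premises on x say that x is nonzero and that C is unbounded in x, which
   together force x to be a limit. *)
Definition is_club d (L : orderType d) (C : set L) : Prop :=
  unbounded C /\
  forall x : L, (exists y, y < x) ->
    (forall y, y < x -> exists2 z, C z & y < z < x) -> C x.

Definition regular_family T (E : set_system T) : Prop :=
  (forall G, G `<=` E -> finite_set G -> \bigcap_(X in G) X !=set0) /\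
  (forall G, G `<=` E -> infinite_set G -> \bigcap_(X in G) X = set0).

Definition card_regular (mu : Type) T (F : set_system T) : Prop :=
  exists2 E : set_system T, E `<=` F & regular_family E /\ E #= [set: mu].

Definition regular_filter T (F : set_system T) : Prop :=
  ProperFilter F /\ card_regular T F.

(* A filter on u i is a filter on the subtype associated with u i; the trace of
   A on u i is then the preimage of A under the inclusion. *)
Definition doubly_plus_regular d (L : orderType d) (D : set_system L) : Prop :=
  ProperFilter D /\
  exists (u : L -> set L) (Di : forall i, set_system (u i)),
    [/\ trivIset [set: L] u,
        forall i, u i #= [set: L],
        forall i, regular_filter (Di i) &
        forall A : set L,
          (exists2 C : set L, is_club C &
             forall i, C i -> Di i [set x : u i | A (val x)]) ->
          D A].

(* M plays the role of the successor cardinal of L. *)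
Definition square_fin d (L : orderType d) d' (M : orderType d')
    (D : set_system L) : Prop :=
  ProperFilter D /\
  exists (C : M -> L -> {fset M}) (n : L -> nat),
    [/\ forall (a : M) (xi : L) (b : M), b \in C a xi -> b <= a,
        forall (B : {fset M}) (a : M), (forall b, b \in B -> b <= a) ->
          D [set xi : L | (B `<=` C a xi)%fset],
        forall (a : M) (xi : L) (b : M), b \in C a xi ->
          C b xi = [fset c in C a xi | c <= b]%fset &
        forall (a : M) (xi : L), (#|` C a xi| < n xi)%N].

(* Main.v *)
(** For each a < lambda^+ fix an injection e_a of a into lambda, and for
    i < lambda write b <_i a when b < a, e_a(b) < i, and the sets
    {c | e_b(c) < i} and {c | e_a(c) < i} agree below b.  Then <_i is a tree
    order in which every node has fewer than lambda predecessors, so some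
    h_i : lambda^+ -> lambda increases along its branches; and since lambda is
    regular and uncountable, for fixed b < a the relation b <_i a holds for club
    many i.  Let (A^i_j), j < lambda, be a regular family in D_i.  For xi in
    u_i, let C_a^xi consist of a together with the b <_i a such that xi lies in
    A^i_(h_i(b)).  Coherence is inherited from the tree order, and C_a^xi is
    finite of size bounded independently of a because xi lies in only finitely
    many A^i_j. *)

Require Import Defs.
From HB Require Import structures.
From mathcomp Require Import all_boot all_order finmap.
From mathcomp Require Import boolp classical_sets functions cardinality filter.
Set Implicit Arguments.
Unset Strict Implicit.
Unset Printing Implicit Defensive.
Import Order.TTheory.
Local Open Scope classical_set_scope.
Local Open Scope card_scope.
Local Open Scope order_scope.

Lemma well_ordered_min d (T : orderType d) (A : set T) :
  well_ordered T -> A !=set0 -> exists2 x, A x & forall y, A y -> x <= y.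
Proof.
move=> T_wo [a Aa].
have [|x [[Ax xmin] _]] := T_wo (fun y => `[< A y >]).
  by exists a; apply/asboolP.
exists x => [|y Ay]; first exact/asboolP.
by apply: xmin; apply/asboolP.
Qed.

Lemma well_ordered_wf d (T : orderType d) :
  well_ordered T -> well_founded (fun x y : T => x < y).
Proof.
move=> T_wo x; apply: contrapT => nAx.
have [|m nAm mmin] := @well_ordered_min _ _
    [set y | ~ Acc (fun x y : T => x < y) y] T_wo.
  by exists x.
apply: nAm; constructor => y ym; apply: contrapT => /mmin.
by rewrite leNgt ym.
Qed.

Lemma injection_ex (T : Type) (U : choiceType) (u : U) (A : set T) :
  A #<= [set: U] -> exists f : T -> U, {in A &, injective f}.
Proof.
pose U' : pointedType := HB.pack U (isPointed.Build U u).
by move=> /(@pcard_injP _ U').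
Qed.

(** For regular [L] this amounts to [X] having smaller cardinality than [L], in the form in which it
    is used: as a supply of strict bounds. *)
Definition small d (L : orderType d) T (X : set T) : Prop :=
  forall f : T -> L, exists x, forall c, X c -> f c < x.

Section RegularCardinal.
Variables (d : Order.disp_t) (L : orderType d).
Hypothesis L_regular : is_regular_cardinal L.

Lemma regular_no_max (x : L) : exists y, x < y.
Proof.
have [_ L_inf L_reg] := L_regular.
apply: contrapT => nx; apply: L_inf.
have /L_reg : unbounded [set x].
  move=> y; exists x => //; rewrite leNgt; apply/negP => xy.
  by apply: nx; exists y.
by move/eq_finite_set <-.
Qed.

Lemma not_card_eq_small T (X : set T) :
  ~~ ([set: L] #<= X) -> small L X.
Proof.
have [_ _ L_reg] := L_regular.
move=> nLX f; apply: contrapT => nb.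
have /L_reg : unbounded (f @` X).
  move=> x; apply: contrapT => nx; apply: nb; exists x => c Xc.
  rewrite ltNge; apply/negP => xc; apply: nx; exists (f c); last exact: xc.
  by exists c.
move=> e; move/negP: nLX; apply.
apply: card_le_trans (card_image_le f X).
by move: e; rewrite card_eq_le => /andP[].
Qed.

(** [e] embeds [X] in a proper initial segment of [L], and a cardinal does not embed in such a
    segment. *)
Lemma initial_segment_small T (X : set T) (e : T -> L) x :
  {in X &, injective e} -> (forall c, X c -> e c <= x) -> small L X.
Proof.
have [[_ L_card] _ _] := L_regular.
move=> e_inj ex; apply: not_card_eq_small; apply/negP => LX.
have [y xy] := regular_no_max x.
move/negP: (L_card y); apply; apply: card_le_trans LX _.
have [f] : $|{injfun X >-> [set z | z < y]}|.
  apply/injfunPex; exists e => //= c Xc; apply: le_lt_trans xy; exact: ex.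
exact: inj_card_le f.
Qed.

Hypothesis L_uncountable : ~ countable [set: L].

Lemma nat_small : small L [set: nat].
Proof. by apply: not_card_eq_small; apply/negP. Qed.

Lemma closure_point (F : L -> L) x0 :
  exists2 x, x0 < x & forall u, u < x -> exists2 w, u <= w & F w < x.
Proof.
have [[L_wo _] _ _] := L_regular.
(* The witness is the least strict upper bound of the iterates of [F] at [x0]. They are bounded
   because [L] has uncountable cofinality, and by minimality every [u] below [x] is reached by some
   iterate. *)
have [|x bx xmin] := @well_ordered_min _ L
    [set x | forall n, iter n F x0 < x] L_wo.
  by have [x xP] := nat_small (fun n => iter n F x0); exists x => n; apply: xP.
exists x => [|u ux]; first exact: (bx 0).
apply: contrapT => nu.
suff /xmin : forall n, iter n F x0 < u by rewrite leNgt ux.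
move=> n; rewrite ltNge; apply/negP => un.
by apply: nu; exists (iter n F x0) => //; apply: (bx n.+1).
Qed.

(** With [X] the predecessors of [b], [e] and [f] the injections of [b] and [a], and [p] the value
    of [f] at [b], this is the set of [i] for which [b] precedes [a] in the [i]-th tree order. *)
Lemma club_agree T (X : set T) (e f : T -> L) (p : L) :
  {in X &, injective e} -> {in X &, injective f} ->
  is_club [set i | p < i /\ forall c, X c -> (e c < i) = (f c < i)].
Proof.
move=> e_inj f_inj; split=> [x0|x [y yx] lim_x] /=.
  (* By injectivity few points have [e]-value at most [y], so their [f]-values are bounded, and
     symmetrically. The two maps agree at every closure point of the resulting [F]. *)
  have /choice[F FP] : forall y, exists x, forall c, X c ->
      (e c <= y -> f c < x) /\ (f c <= y -> e c < x).
    move=> y.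
    have [x xP] : exists x, forall c, (X `&` [set c | e c <= y]) c -> f c < x.
      apply: (@initial_segment_small _ _ e y) => [c c' | c []//].
      by rewrite !inE => -[? _] [? _]; apply: e_inj; rewrite inE.
    have [z zP] : exists x, forall c, (X `&` [set c | f c <= y]) c -> e c < x.
      apply: (@initial_segment_small _ _ f y) => [c c' | c []//].
      by rewrite !inE => -[? _] [? _]; apply: f_inj; rewrite inE.
    exists (Order.max x z) => c Xc; rewrite !lt_max; split => h.
      by rewrite xP.
    by rewrite zP ?orbT.
  have [x] := closure_point F (Order.max x0 p).
  rewrite gt_max => /andP[x0x px] xP; exists x; last exact: ltW.
  split=> // c Xc; apply/idP/idP => /xP [w cw]; apply: lt_trans.
    by have [+ _] := FP w c Xc; apply.
  by have [_] := FP w c Xc; apply.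
have [z0 [pz0 _] /andP[_ z0x]] := lim_x y yx.
split=> [|c Xc]; first exact: lt_trans z0x.
by apply/idP/idP => /lim_x [z [_ /(_ c Xc) ez] /andP[cz /(lt_trans _)]]; apply;
  [rewrite -ez | rewrite ez].
Qed.

End RegularCardinal.

Lemma strictly_increasing_ranking d (L : orderType d) d' (M : orderType d')
    (R : M -> M -> Prop) (l0 : L) :
  well_ordered M -> (forall a, small L [set b | R b a]) ->
  (forall b a, R b a -> b < a) ->
  exists h : M -> L, forall b a, R b a -> h b < h a.
Proof.
move=> M_wo R_small R_lt.
have [F FP] : {F : M -> (M -> L) -> L & forall a g b, R b a -> g b < F a g}.
  have /choice[F FP] (ag : M * (M -> L)) := R_small ag.1 ag.2.
  by exists (fun a g => F (a, g)) => a g b; apply: (FP (a, g)).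
(* Well-founded recursion: the value at [a] strictly bounds the values at its [R]-predecessors. The
   default [l0] is harmless, since [R b a] implies [b < a]. *)
pose G a (g : forall b, b < a -> L) :=
  F a (fun b => if pselect (b < a) is left ba then g b ba else l0).
exists (Fix (well_ordered_wf M_wo) (fun=> L) G) => b a Rba.
rewrite [ltRHS]Fix_eq => [|x f g fg]; last first.
  by congr F; apply/funext => y; case: pselect.
have := FP a (fun c => if pselect (c < a) is left _
  then Fix (well_ordered_wf M_wo) (fun=> L) G c else l0) b Rba.
by case: pselect (R_lt _ _ Rba).
Qed.

(** The predecessors of a node form a chain, on which [h] is injective. Hence at most as many of
    them have their label in [Q] as [Q] has elements, whatever the node. *)
Lemma finite_forest d (M : orderType d) (L : choiceType) (R : M -> M -> Prop)
    (h : M -> L) (Q : set L) :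
  (forall b a, R b a -> b < a) ->
  (forall c b a, R c b -> R b a -> R c a) ->
  (forall c b a, R c a -> R b a -> c < b -> R c b) ->
  (forall b a, R b a -> h b <> h a) ->
  finite_set Q ->
  exists (C : M -> {fset M}) (n : nat),
    [/\ forall a b, b \in C a <-> b = a \/ R b a /\ Q (h b),
        forall a b, b \in C a -> b <= a,
        forall a b, b \in C a -> C b = [fset c in C a | c <= b]%fset &
        forall a, (#|` C a| < n)%N].
Proof.
move=> R_lt R_trans R_comp h_inj Qfin.
pose S a := [set b | R b a /\ Q (h b)].
have S_inj a : {in S a &, injective h}.
  move=> b c; rewrite !inE => -[Rb _] [Rc _] e.
  case: (ltgtP b c) => // bc.
    by case: (h_inj b c (R_comp _ _ _ Rb Rc bc)).
  by case: (h_inj c b (R_comp _ _ _ Rc Rb bc)).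
have Sfin a : finite_set (S a).
  have [f] : $|{injfun S a >-> Q}|.
    by apply/injfunPex; exists h; [move=> b [] | apply: S_inj].
  exact: card_le_finite (inj_card_le f) Qfin.
have [C C_def] : exists C, forall a, C a = (a |` fset_set (S a))%fset.
  by exists (fun a => (a |` fset_set (S a))%fset).
have C_E a b : b \in C a <-> b = a \/ S a b.
  rewrite C_def in_fset1U in_fset_set//.
  by split=> [/orP[/eqP|/set_mem]|[->|/mem_set->]]; rewrite ?eqxx ?orbT; auto.
have C_le a b : b \in C a -> b <= a by move=> /C_E[->//|[/R_lt/ltW]].
(* One unit accounts for [a] itself, the other for the strict inequality. *)
exists C, (#|` fset_set Q|.+2); split=> // [a b /C_E[->|[Rba Qb]]|a].
- apply/fsetP => c; rewrite !inE /=.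
  by case: (boolP (c \in C a)) => //= /C_le.
- apply/fsetP => c; rewrite !inE /=; apply/idP/andP => [cb|[/C_E ca cb]].
    split; last exact: C_le.
    by apply/C_E; right; case/C_E: cb => [->//|[Rcb Qc]]; split=> //;
      exact: R_trans Rcb Rba.
  apply/C_E; move: cb; rewrite le_eqVlt => /predU1P[->|cb]; first by left.
  case: ca => [ca|[Rca Qc]].
    by move: (R_lt _ _ Rba); rewrite -ca ltNge (ltW cb).
  by right; split=> //; exact: R_comp Rca Rba cb.
rewrite C_def cardfsU1 ltnS -add1n leq_add ?leq_b1//.
have <- : #|` [fset h b | b in fset_set (S a)]%fset| = #|` fset_set (S a)|.
  apply: card_in_imfset => b c /=; rewrite !in_fset_set//.
  exact: S_inj.
apply: fsubset_leq_card; apply/fsubsetP => _ /imfsetP[b /= + ->].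
by rewrite !in_fset_set// !inE => -[].
Qed.

(** Otherwise injectivity of [g] would give infinitely many members of [E] with [x] in their
    intersection. *)
Lemma regular_family_point_finite T I (g : I -> set T) (E : set_system T) :
  injective g -> (forall j, E (g j)) -> regular_family E ->
  forall x, finite_set [set j | g j x].
Proof.
move=> g_inj Eg [_ E_inf] x; apply: contrapT => inf.
suff : (\bigcap_(X in g @` [set j | g j x]) X) x.
  rewrite E_inf// => [_ [j _ <-]//|fin]; apply: inf.
  apply: card_le_finite fin.
  have [f] : $|{injfun [set j | g j x] >-> g @` [set j | g j x]}|.
    apply/injfunPex; exists g; first by move=> j /= gj; exists j.
    by move=> ? ? _ _ /g_inj.
  exact: inj_card_le f.
by move=> _ [j gj <-].
Qed.

Theorem theorem5 (d : Order.disp_t) (L : orderType d)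
    (L_regular : is_regular_cardinal L)
    (L_uncountable : ~ countable [set: L]%classic)
    (d' : Order.disp_t) (M : orderType d')
    (M_succ : is_successor_cardinal L M)
    (D : set_system L) (D_regular : doubly_plus_regular D) :
  square_fin M D.
Proof.
have [D_filter [u [Di [u_disj u_card Di_reg D_club]]]] := D_regular.
have [M_wo _ M_le] := M_succ.
split=> //.
have l0 : L.
  have [_ L_inf _] := L_regular.
  have /set0P/cid[l _] // : [set: L] != set0.
  by apply/eqP => L0; apply: L_inf; rewrite L0.
have /choice[e e_inj] (a : M) :
    exists f : M -> L, {in [set b | b < a] &, injective f}.
  exact: (injection_ex l0 (M_le a)).
pose R i b a := [/\ b < a, e a b < i &
  forall c, c < b -> (e b c < i) = (e a c < i)].
have R_lt i b a : R i b a -> b < a by case.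
have R_trans i c b a : R i c b -> R i b a -> R i c a.
  move=> [cb ecb cP] [ba eba bP]; split; first exact: lt_trans ba.
    by rewrite -bP.
  by move=> x xc; rewrite cP// bP// (lt_trans xc).
have R_comp i c b a : R i c a -> R i b a -> c < b -> R i c b.
  move=> [ca eca cP] [ba eba bP] cb; split=> //; first by rewrite bP.
  by move=> x xc; rewrite cP// bP// (lt_trans xc).
have R_small i a : small L [set b | R i b a].
  apply: (@initial_segment_small _ _ L_regular _ _ (e a) i); last first.
    by move=> b [_ /ltW].
  move=> b c.
  by move=> /set_mem[ba _ _] /set_mem[ca _ _]; apply: e_inj; apply/mem_set.
have /choice[h h_lt] i :=
  strictly_increasing_ranking l0 M_wo (R_small i) (@R_lt i).
have h_inj i b a : R i b a -> h i b <> h i a.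
  by move=> /h_lt + E; rewrite E ltxx.
have g_ex i : exists g : L -> set (u i),
    [/\ injective g, forall j, Di i (g j) &
        forall x, finite_set [set j | g j x]].
  have [_ [E E_Di [E_reg E_card]]] := Di_reg i.
  (* The regular family has the cardinality of [u i], hence that of [L], so the labels in [L] can
     index distinct members of it. *)
  have /pcard_leP/injfunPex[g g_fun g_set_inj] : [set: L] #<= E.
    by rewrite (card_le_eqr E_card) (card_le_eqr (card_setT _))
      -(card_le_eql (u_card i)).
  have g_inj : injective g by move=> x y; apply: g_set_inj; rewrite inE.
  have Eg j : E (g j) by apply: g_fun.
  exists g; split=> // [j|x]; first exact/E_Di/Eg.
  exact: regular_family_point_finite g_inj Eg E_reg x.
pose g i := projT1 (cid (g_ex i)).
have gP i : [/\ injective (g i), forall j, Di i (g i j) &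
    forall x, finite_set [set j | g i j x]] by exact: projT2 (cid (g_ex i)).
have forest xi : exists (C : M -> {fset M}) (n : nat),
    [/\ forall a, a \in C a,
        forall a b, b \in C a -> b <= a,
        forall a b, b \in C a -> C b = [fset c in C a | c <= b]%fset,
        forall a, (#|` C a| < n)%N &
        forall i (x : u i), val x = xi -> forall b a, R i b a ->
          g i (h i b) x -> b \in C a].
  have [[i [x xE]]|nx] := pselect (exists i (x : u i), val x = xi).
    have [_ _ /(_ x) Qfin] := gP i.
    have [C [n [C_E C_le C_coh C_n]]] :=
      finite_forest (@R_lt i) (@R_trans i) (@R_comp i) (@h_inj i) Qfin.
    exists C, n; split=> // [a|j y yE]; first by apply/C_E; left.
    (* Disjointness of the [u i] leaves only one tree order to serve at [xi]. *)
    have ij : j = i.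
      apply: u_disj => //; exists xi; split; [rewrite -yE | rewrite -xE];
        exact: set_valP.
    subst j => b a Rba; have -> : y = x by apply: val_inj; rewrite xE.
    by move=> gx; apply/C_E; right.
  (* When [xi] lies in no [u i], singletons suffice: the last clause is vacuous. *)
  exists (fun a => [fset a]%fset), 2.
  split=> [a|a b|a b|a|i x xE]; rewrite ?inE ?cardfs1//; last first.
    by case: nx; exists i, x.
  - move=> /eqP ->; apply/fsetP => c; rewrite !inE /=.
    by case: eqVneq => // ->; rewrite lexx.
  - by move=> /eqP->.
have /choice[C /choice[n CP]] := forest.
exists (fun a xi => C xi a), n; split.
- by move=> a xi b; have [_ + _ _ _] := CP xi; apply.
- move=> B a Ba.
  have [DF _] := D_filter.
  (* As [B] is finite, it is enough to treat each [b] separately; the case [b = a] gives all of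
     [L]. *)
  rewrite (_ : [set _ | _] = \bigcap_(b in [set` B]) [set xi | b \in C xi a]).
    apply: filter_bigI => b /Ba; rewrite le_eqVlt => /predU1P[->|ba].
      by apply: filterS filterT => xi _ /=; have [+ _ _ _ _] := CP xi; apply.
    (* For [i] in this club [R i b a] holds, so the trace on [u i] contains [g i (h i b)], a member
       of [Di i]. *)
    apply: D_club; exists [set i | e a b < i /\ forall c, c < b ->
        (e b c < i) = (e a c < i)].
      apply: (club_agree L_regular L_uncountable _ (e_inj b)) => x y.
      by move=> /set_mem /= xb /set_mem /= yb; apply: (e_inj a); apply/mem_set;
        apply: lt_trans ba.
    move=> i [eab iP]; have [_ + _] := gP i => /(_ (h i b)).
    have [Di_filter _] := Di_reg i.
    apply: filterS => x gx /=.
    have [_ _ _ _ CR] := CP (val x).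
    exact: (CR i x erefl b a).
  apply/seteqP; split=> xi /=; first by move=> /fsubsetP BC b /BC.
  by move=> BC; apply/fsubsetP => b /BC.
- by move=> a xi b; have [_ _ + _ _] := CP xi; apply.
- by move=> a xi; have [_ _ _ + _] := CP xi; apply.
Qed.
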